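(* Let $X$ be a real Banach space and let $\Phi_1,\Phi_2:X\to[0,\infty]$ be lower semi-continuous and coercive semi-norms on $X$ (in the sense defined in the context) with finite-dimensional kernels. Assume that either (a) $X$ is reflexive, or (b) for $i=1$ or $i=2$, the sets $\{u\in X:\|u\|_X+\Phi_i(u)\le C\}$ are weakly relatively compact for each $C>0$. Then $\Phi_1\,\Box\,\Phi_2$ is exact, i.e., for each $u\in X$ there is $v^*\in X$ such that $$v^*\in\operatorname*{arg\,min}_{v\in X}\ \Phi_1(u-v)+\Phi_2(v).$$ Moreover, $\Phi_1\,\Box\,\Phi_2$ is a lower semi-continuous semi-norm on $X$ with finite-dimensional kernel.
   Context: The infimal convolution is $(\Phi_1\,\Box\,\Phi_2)(u)=\inf_{v\in X}\Phi_1(u-v)+\Phi_2(v)$ for $u\in X$. A functional $\Phi:X\to[0,\infty]$ on a real Banach space $X$ is a lower semi-continuous semi-norm if: (1) $\Phi$ is proper (finite somewhere); (2) $\Phi(\lambda u)=|\lambda|\Phi(u)$ for all $\lambda\in\mathbb{R}$, $u\in X$ (with $0\cdot\infty=0$); (3) $\Phi(u+v)\le\Phi(u)+\Phi(v)$; (4) $\Phi(u)\le\liminf_n\Phi(u^n)$ whenever $u^n\to u$ in $X$; (5) there is a linear continuous projection $P$ of $X$ onto $\ker(\Phi)=\{u\in X:\Phi(u)=0\}$. It is coercive in $X$ if there is a constant $C>0$ with $\|u-Pu\|_X\le C\,\Phi(u)$ for all $u\in X$, $P$ being the projection in (5). *)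

(* Defs.v *)
From HB Require Import structures.
From mathcomp Require Import all_boot all_order all_algebra.
From mathcomp Require Import all_classical all_reals all_analysis.

Set Implicit Arguments.
Unset Strict Implicit.
Unset Printing Implicit Defensive.

Import Order.TTheory GRing.Theory Num.Theory.
Import numFieldNormedType.Exports.

Local Open Scope classical_set_scope.
Local Open Scope ring_scope.

Section TopologicalDual.
Context {R : realType} (X : normedModType R).

Definition continuous_linear : {pred X -> R^o} :=
  mem [set f : X -> R^o | linear f /\ continuous f].

Record topdual := TopDual {
  topdual_fun :> X -> R^o ;
  topdual_funP : topdual_fun \in continuous_linear }.

HB.instance Definition _ := [isSub for topdual_fun].
HB.instance Definition _ := [Choice of topdual by <:].

Let continuous_linear_submod_closed : submod_closed continuous_linear.
Proof.
split=> [|a f g].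
  by rewrite inE; split=> [b x y|x]; [rewrite scaler0 addr0|exact: cvg_cst].
rewrite !inE => -[lf cf] [lg cg]; split=> [b x y|x].
  rewrite [LHS]/(a *: f (b *: x + y) + g (b *: x + y)) lf lg.
  rewrite !scalerDr addrACA; congr (_ + _ + _).
  by rewrite !scalerA mulrC.
by apply: cvgD; [apply: cvgZl_tmp; exact: cf|exact: cg].
Qed.

HB.instance Definition _ := GRing.isSubmodClosed.Build R (X -> R^o)
  continuous_linear continuous_linear_submod_closed.
HB.instance Definition _ := [SubChoice_isSubLmodule of topdual by <:].

Lemma topdual_linear (f : topdual) : linear f.
Proof. by case: f => f /=; rewrite inE => -[]. Qed.

Lemma topdual_continuous (f : topdual) : continuous f.
Proof. by case: f => f /=; rewrite inE => -[]. Qed.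

HB.instance Definition _ (f : topdual) :=
  GRing.isLinear.Build R X R^o _ f (topdual_linear f).

Definition opnorm (f : topdual) : R := sup [set `|f x| | x in [set x | `|x| <= 1]].

Lemma opnorm_has_sup (f : topdual) :
  has_sup [set `|f x| | x in [set x | `|x| <= 1]].
Proof.
split; first by exists `|f 0|, 0 => //=; rewrite normr0.
have /linear_boundedP : bounded_near f (nbhs 0).
  by apply/linear_bounded_continuous; exact: topdual_continuous.
move=> /pinfty_ex_gt0[M M0 fM]; exists M => _ [x /= x1 <-].
by rewrite (le_trans (fM x))// ler_piMr// ltW.
Qed.

Lemma opnorm_ub (f : topdual) x : `|x| <= 1 -> `|f x| <= opnorm f.
Proof. by move=> x1; apply: sup_upper_bound; [exact: opnorm_has_sup|exists x]. Qed.

Lemma opnorm_le (f : topdual) M :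
  (forall x, `|x| <= 1 -> `|f x| <= M) -> opnorm f <= M.
Proof.
by move=> fM; apply: ge_sup => [|_ [x /= x1 <-]]; [case: (opnorm_has_sup f)|exact: fM].
Qed.

Lemma opnormD (f g : topdual) : opnorm (f + g) <= opnorm f + opnorm g.
Proof.
by apply: opnorm_le => x x1; rewrite (le_trans (ler_normD _ _))// lerD ?opnorm_ub.
Qed.

Lemma opnormZ_le (a : R) (f : topdual) : opnorm (a *: f) <= `|a| * opnorm f.
Proof.
apply: opnorm_le => x x1; rewrite [X in `|X|]/(a * f x) normrM.
by rewrite ler_wpM2l// opnorm_ub.
Qed.

Lemma opnormZ (a : R) (f : topdual) : opnorm (a *: f) = `|a| * opnorm f.
Proof.
apply/eqP; rewrite eq_le opnormZ_le /=.
have [->|a0] := eqVneq a 0.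
  by rewrite normr0 mul0r (le_trans _ (opnorm_ub _ (x := 0) _))// normr0.
rewrite -ler_pdivlMl ?normr_gt0// -normfV.
by rewrite (le_trans _ (opnormZ_le _ _))// scalerA mulVf// scale1r.
Qed.

Lemma opnorm_eq0 (f : topdual) : opnorm f = 0 -> f = 0.
Proof.
move=> f0; apply/val_inj/funext => x /=.
have [->|x0] := eqVneq x 0; first exact: linear0.
have : `|f (`|x|^-1 *: x)| <= 0.
  by rewrite -f0 opnorm_ub// normrZ normfV normr_id mulVf ?normr_eq0.
rewrite normr_le0 linearZ /= scaler_eq0 invr_eq0 normr_eq0 (negbTE x0) /=.
by move/eqP.
Qed.

HB.instance Definition _ := Lmodule_isNormed.Build R topdual
  opnormD opnormZ opnorm_eq0.

End TopologicalDual.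

(* Surjectivity of the canonical embedding of X into its bidual. *)
Definition reflexive_space {R : realType} (X : normedModType R) : Prop :=
  forall F : topdual (topdual X), exists x : X, forall f : topdual X, F f = f x.

Definition weak {R : realType} (X : normedModType R) : topologicalType :=
  sup_topology (fun f : topdual X =>
    Topological.on (initial_topology (f : X -> R^o))).

Section Seminorms.
Context {R : realType} {X : normedModType R}.
Implicit Types (Phi : X -> \bar R) (P : {linear X -> X}).
Local Open Scope ereal_scope.

Definition seminorm_ker Phi : set X := [set u | Phi u = 0].

Definition kernel_projection Phi P : Prop :=
  [/\ continuous P, idempotent_fun P & range P = seminorm_ker Phi].

Record lsc_seminorm Phi : Prop := {
  seminorm_ge0 : forall u, 0 <= Phi u ;
  seminorm_proper : exists u, Phi u < +oo ;
  seminormZ : forall (a : R) u, Phi (a *: u) = `|a|%:E * Phi u ;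
  seminormD : forall u v, Phi (u + v)%R <= Phi u + Phi v ;
  seminorm_lsc : forall (u_ : nat -> X) (u : X),
    u_ @ \oo --> u -> Phi u <= limn_einf (Phi \o u_) ;
  seminorm_projection : exists P, kernel_projection Phi P }.

(* Independent of the choice of P: if P and Q are continuous projections onto
   the kernel, then u - Q u = (id - Q) (u - P u). *)
Definition coercive Phi : Prop :=
  exists2 P, kernel_projection Phi P &
    exists2 C : R, (0 < C)%R & forall u, `|(u - P u)%R|%:E <= C%:E * Phi u.

Definition finite_dimensional (V : set X) : Prop :=
  exists n (e : 'I_n -> X),
    V = range (fun c : 'I_n -> R => (\sum_(i < n) c i *: e i)%R).

Definition infconv Phi1 Phi2 (u : X) : \bar R :=
  ereal_inf (range (fun v => Phi1 (u - v)%R + Phi2 v)).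

Definition argmin (f : X -> \bar R) : set X :=
  [set v | forall w, f v <= f w].

Definition weakly_relatively_compact (A : set X) : Prop :=
  precompact (A : set (weak X)).

Definition weakly_compact_sublevels Phi : Prop :=
  forall C : R, (0 < C)%R ->
    weakly_relatively_compact [set u | `|u|%:E + Phi u <= C%:E].

End Seminorms.

(* Main.v *)
(* Instead of weak topologies, the proof uses the following notion: x is a weak
   cluster point of x_n if f x <= sup_(k >= n) f (x_k) for every continuous
   linear f and every n. In a reflexive space a bounded sequence has one, since
   f |-> limsup f (x_k) is sublinear on the dual and dominates, by Hahn-Banach,
   an element of the bidual, i.e. an evaluation at a point; in a weakly
   relatively compact set any weak topological cluster point will do. By
   separation, x is then in the closure of every convex set containing a tail of
   the sequence.

   Given l and u, let S_n be the set of all v in a fixed ball for which some w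
   with |u - w| <= 1/n satisfies Phi1 (w - v) + Phi2 v <= l + 1/n. These sets are
   convex and decreasing, so if none is empty they have a common adherent point
   x, and lower semi-continuity gives Phi1 (u - x) + Phi2 x <= l. With w = u this
   is the existence of a minimizer; with w ranging over a sequence tending to u
   it is the lower semi-continuity of the infimal convolution.

   That v can be kept in a ball follows by subtracting an element of
   ker Phi1 :&: ker Phi2: coercivity bounds a - b for a = P1 (v - w) and
   b = P2 v, and if T is continuous with values in ker Phi1, vanishes on ker Phi2
   and satisfies a - T a \in ker Phi2 on ker Phi1, then z = a - T (a - b) lies in
   both kernels and |a - z| <= |T| |a - b|. The same T yields a continuous
   projection T + P2 (id - T) onto ker Phi1 + ker Phi2, the kernel of the infimal
   convolution. *)
From HB Require Import structures.
Require Import Defs.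
From mathcomp Require Import all_boot all_order all_algebra.
From mathcomp Require Import all_classical all_reals all_analysis.
From mathcomp Require Import ring lra.
Import Order.TTheory GRing.Theory Num.Theory.
Import numFieldNormedType.Exports.
Set Implicit Arguments.
Unset Strict Implicit.
Unset Printing Implicit Defensive.
Local Open Scope classical_set_scope.
Local Open Scope ring_scope.

(** * The Hahn-Banach theorem, through maximal cones above sublinear functionals *)

Section HahnBanach.
Context {R : realType} {V : lmodType R}.

(* A cone lying above the graph of a sublinear functional x |-> inf {c | G (x, c)};
   working with G avoids computing infima for each such functional. *)
Definition dominating_cone (G : set (V * R)) : Prop :=
  [/\ forall x y c d, G (x, c) -> G (y, d) -> G (x + y, c + d),
      forall t x c, 0 <= t -> G (x, c) -> G (t *: x, t * c),
      forall x, exists c, G (x, c) &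
      forall c, G (0, c) -> 0 <= c].

(** Zorn's lemma is applied to the sets whose union with [G] is a dominating cone, so that the empty
    chain causes no trouble. Each closure condition involves at most two members of a chain, and
    totality is inherited from [G]. *)
Lemma maximal_dominating_cone (G : set (V * R)) : dominating_cone G ->
  exists2 M, dominating_cone M /\ G `<=` M &
    forall M', dominating_cone M' -> M `<=` M' -> M' `<=` M.
Proof.
move=> coneG.
have [F FP totF|A [coneA maxA]] :=
    @Zorn_bigcup _ [set A | dominating_cone (A `|` G)].
  have [F0|/set0P[A0 FA0]] := eqVneq F set0.
    by rewrite /= F0 bigcup_set0 set0U.
  have memU A z : F A -> (A `|` G) z -> (\bigcup_(X in F) X `|` G) z.
    by move=> FA [Az|Gz]; [left; exists A|right].
  have inU z : (\bigcup_(X in F) X `|` G) z -> exists2 A, F A & (A `|` G) z.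
    by move=> [[A FA Az]|Gz]; [exists A => //; left|exists A0 => //; right].
  split=> [x y c d /inU[A FA Ax] /inU[B FB By]|t x c t0 /inU[A FA Ax]|x|c].
  - have [AB|BA] := totF _ _ FA FB.
      apply: (memU B) => //; have [addB _ _ _] := FP _ FB; apply: addB => //.
      exact: setSU Ax.
    apply: (memU A) => //; have [addA _ _ _] := FP _ FA; apply: addA => //.
    exact: setSU By.
  - by apply: (memU A) => //; have [_ scA _ _] := FP _ FA; exact: scA.
  - by have [_ _ /(_ x)[c Gc] _] := coneG; exists c; right.
  - by move=> /inU[A FA]; have [_ _ _] := FP _ FA; exact.
exists (A `|` G); first by split=> //; exact: subsetUr.
move=> M' coneM' AM'; apply: contrapT => M'A.
apply: (maxA M'); last first.
  by rewrite /= setUidl//; exact: subset_trans AM'; exact: subsetUr.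
split; first by apply: subset_trans AM'; exact: subsetUl.
by move=> M'subA; apply: M'A; apply: subset_trans M'subA _; exact: subsetUl.
Qed.

(** The sublinear functional [q] below a maximal cone is odd; with subadditivity and positive
    homogeneity this makes it linear. *)
Theorem Hahn_Banach (G : set (V * R)) : dominating_cone G ->
  exists f : {linear V -> R^o}, forall x c, G (x, c) -> f x <= c.
Proof.
move=> /maximal_dominating_cone[M [[addM scM totM M0] GM] maxM].
have M00 : M (0, 0).
  by have [c /(scM 0)] := totM 0; rewrite scale0r mul0r; exact.
pose q x := inf [set c | M (x, c)].
have lbM x : has_inf [set c | M (x, c)].
  split; first exact: totM.
  have [d Md] := totM (- x); exists (- d) => c /= Mc.
  by rewrite -subr_ge0 opprK; apply: M0; rewrite -(subrr x); exact: addM.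
have q_le x c : M (x, c) -> q x <= c.
  by move=> Mc; apply: ge_inf => //; have [] := lbM x.
have le_q x c : (forall d, M (x, d) -> c <= d) -> c <= q x.
  by move=> cM; apply: lb_le_inf; [have [] := lbM x|].
have MN x : M (- x, - q x).
  (* The cone above y |-> inf_(t >= 0) q (y + t x) - t q x: by maximality of M
     it adds nothing to M, which forces q to be odd, hence linear. *)
  pose M' := [set z : V * R | exists t e,
    [/\ 0 <= t, M (z.1 + t *: x, e) & e - t * q x <= z.2]].
  apply: (maxM M'); last first.
  - by exists 1, 0; rewrite /= scale1r addNr mul1r sub0r.
  - move=> [y c] Mc; exists 0, c => /=.
    by rewrite scale0r addr0 mul0r subr0.
  split=> [y z c d [t [e [t0 Me ec]]] [s [k [s0 Mk kd]]]|
           s y c s0 [t [e [t0 Me ec]]]|y|c [t [e [t0]]]].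
  - exists (t + s), (e + k); split; [exact: addr_ge0| |].
      by rewrite scalerDl /= addrACA; exact: addM.
    by rewrite mulrDl opprD addrACA /= lerD.
  - exists (s * t), (s * e); split; [exact: mulr_ge0| |].
      by rewrite /= -scalerA -scalerDr; exact: scM.
    by rewrite -mulrA -mulrBr /= ler_wpM2l.
  - by have [c Mc] := totM y; exists c, 0, c; rewrite scale0r addr0 mul0r subr0.
  rewrite /= add0r => Mt; apply: le_trans; rewrite subr_ge0.
  have [t_eq0|t_neq0] := eqVneq t 0.
    by move: Mt; rewrite t_eq0 scale0r mul0r; exact: M0.
  have t_gt0 : 0 < t by rewrite lt_def t_neq0.
  rewrite -ler_pdivlMl//; apply: q_le.
  rewrite -[X in (X, _)]scale1r -(mulVf t_neq0) -scalerA.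
  by apply: scM => //; rewrite invr_ge0.
have qN x : q (- x) = - q x.
  apply/eqP; rewrite eq_le q_le//=; apply: (le_q) => d Md.
  rewrite lerNl; apply: le_q => c Mc; rewrite -subr_ge0 opprK.
  by apply: M0; rewrite -(subrr x); exact: addM.
have Mq x : M (x, q x) by have := MN (- x); rewrite opprK qN opprK.
have qD x y : q (x + y) = q x + q y.
  have qD_le u v : q (u + v) <= q u + q v by apply: q_le; exact: addM.
  apply/eqP; rewrite eq_le qD_le /= -[X in q X + _](addrK y).
  by rewrite -lerBrDr -qN.
have qZ t x : q (t *: x) = t * q x.
  wlog t0 : t / 0 <= t => [wlogt|].
    have [|/ltW t0] := leP 0 t; first exact: wlogt.
    by rewrite -[t]opprK mulNr scaleNr qN wlogt ?oppr_ge0.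
  have qZ_le u : q (t *: u) <= t * q u by apply: q_le; exact: scM.
  by apply/eqP; rewrite eq_le qZ_le/= -lerN2 -qN -mulrN -qN -scalerN.
have q_lin : linear (q : V -> R^o) by move=> t x y; rewrite qD qZ.
exists (HB.pack_for {linear V -> R^o} (q : V -> R^o)
  (GRing.isLinear.Build R V R^o _ _ q_lin)).
by move=> x c /GM; exact: q_le.
Qed.
End HahnBanach.

(** * Separation of a point from a convex set, and weak cluster points *)

Section WeakClusterPoints.
Context {R : realType} {X : normedModType R}.

Lemma bounded_linear_topdual (Y : normedModType R) (M : R)
    (f : {linear Y -> R^o}) :
  (forall y, `|f y| <= M * `|y|) -> exists g : topdual Y, g = f :> (Y -> R).
Proof.
move=> fM; suff cf : continuous f.
  have fP : (f : Y -> R^o) \in @continuous_linear R Y.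
    by rewrite inE; split=> // a x y; rewrite linearP.
  by exists (TopDual fP).
apply/linear_bounded_continuous/linear_boundedP.
have M_le : \forall N \near +oo_R, M <= N.
  by apply: nbhs_pinfty_ge; exact: num_real.
apply: filterS M_le => N MN y.
by apply: le_trans (fM y) _; rewrite ler_wpM2r.
Qed.

(** The bound [M * |y|], used at [y] and at [- y], makes the Hahn-Banach functional continuous. *)
Lemma topdual_dominated (Y : normedModType R) (M : R) (G : set (Y * R)) :
    dominating_cone G -> (forall y, G (y, M * `|y|)) ->
  exists f : topdual Y, forall y c, G (y, c) -> f y <= c.
Proof.
move=> /Hahn_Banach[f fG] GM.
have [|g gf] := @bounded_linear_topdual Y M f.
  move=> y; rewrite ler_norml fG// andbT lerNl.
  by rewrite -[leLHS](linearN f) -normrN fG.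
by exists g => y c; rewrite gf; exact: fG.
Qed.

(** Hahn-Banach for the sublinear functional sending [y] to the infimum of [|y + t (x - s)| - t r]
    over [t >= 0] and [s] in [S]. It is at most [|y|], and at most [- r] at every [s - x]; the
    distance hypothesis makes it nonnegative at [0]. *)
Lemma separate_point_convex (S : set X) (x : X) (r : R) :
    S !=set0 ->
    (forall y z t, S y -> S z -> 0 <= t <= 1 -> S (t *: y + (1 - t) *: z)) ->
    (forall y, S y -> r <= `|x - y|) ->
  exists f : topdual X, forall y, S y -> f y + r <= f x.
Proof.
move=> [s0 Ss0] convS xS.
pose G : set (X * R) := [set z | exists t s,
  [/\ 0 <= t, S s & `|z.1 + t *: (x - s)| - t * r <= z.2]].
have Gnorm y : G (y, 1 * `|y|).
  by exists 0, s0; split=> //=; rewrite scale0r addr0 mul0r subr0 mul1r.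
have coneG : dominating_cone G.
  split.
  - move=> y z c d [t [s [t0 Ss /= tc]]] [k [u [k0 Su /= kd]]].
    (* Convexity of [S] enters here: [v] is the average of [s] and [u] with weights proportional to
       [t] and [k], or any point of [S] if both weights vanish. *)
    have [v Sv tk] : exists2 v, S v &
        t *: (x - s) + k *: (x - u) = (t + k) *: (x - v).
      have [tk0|tk0] := eqVneq (t + k) 0.
        have [-> ->] : t = 0 /\ k = 0 by lra.
        by exists s => //; rewrite addr0 !scale0r addr0.
      have tk_gt0 : 0 < t + k by rewrite lt_def tk0 addr_ge0.
      exists ((t / (t + k)) *: s + (1 - t / (t + k)) *: u).
        apply: convS => //; rewrite divr_ge0 ?addr_ge0//= ler_pdivrMr// mul1r.
        by rewrite lerDl.
      rewrite [RHS]scalerBr [in RHS]scalerDr !scalerA mulrBr mulr1 mulrCA divff//.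
      rewrite mulr1 [X in X *: u]addrAC subrr add0r scalerDl !scalerBr opprD.
      by rewrite addrACA.
    exists (t + k), v; split; [exact: addr_ge0|exact: Sv|].
    rewrite /= -tk addrACA mulrDl.
    have := ler_normD (y + t *: (x - s)) (z + k *: (x - u)); lra.
  - move=> t y c t0 [k [s [k0 Ss /= kc]]]; exists (t * k), s.
    split; [exact: mulr_ge0|by []|].
    by rewrite /= -scalerA -scalerDr normrZ ger0_norm// -mulrA -mulrBr ler_wpM2l.
  - by move=> y; exists (1 * `|y|).
  - move=> c [t [s [t0 Ss /=]]]; rewrite add0r normrZ ger0_norm// -mulrBr.
    by apply: le_trans; rewrite mulr_ge0// subr_ge0 xS.
have [f fG] := topdual_dominated coneG Gnorm.
exists f => s Ss; suff : f (s - x) <= - r by rewrite linearB /=; lra.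
apply: fG; exists 1, s; split=> //=.
by rewrite scale1r mul1r -[s - x]opprB addNr normr0 sub0r.
Qed.

Lemma topdual_neq0 (x : X) : x != 0 -> exists f : topdual X, f x != 0.
Proof.
move=> x0; have [|||f /(_ 0 erefl)] := @separate_point_convex [set 0] x `|x|.
- by exists 0.
- by move=> _ _ t -> -> _; rewrite !scaler0 addr0.
- by move=> _ ->; rewrite subr0.
rewrite linear0 add0r => xf; exists f; rewrite gt_eqF//.
by apply: lt_le_trans xf; rewrite normr_gt0.
Qed.

Lemma topdual_le_opnorm (f : topdual X) x : f x <= opnorm f * `|x|.
Proof.
have [->|x0] := eqVneq x 0; first by rewrite linear0 normr0 mulr0.
rewrite mulrC -ler_pdivrMl ?normr_gt0//.
apply: le_trans (opnorm_ub f (x := `|x|^-1 *: x) _).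
  by apply: le_trans (ler_norm _); rewrite linearZ.
by rewrite normrZ normfV normr_id mulVf ?normr_eq0.
Qed.

(* Dual form of membership of [x] in the closed convex hulls of all the tails
   of [x_]. *)
Definition weak_cluster_point (x_ : nat -> X) (x : X) : Prop :=
  forall (f : topdual X) n c, (forall k, (n <= k)%N -> f (x_ k) <= c) -> f x <= c.

Lemma reflexive_weak_cluster (x_ : nat -> X) (C : R) :
    reflexive_space X -> (forall n, `|x_ n| <= C) ->
  exists x, weak_cluster_point x_ x.
Proof.
move=> reflX x_C.
(* The pairs [(f, c)] with [f (x_ k) <= c] eventually: a cone above the upper limit of
   [f (x_ k)]. *)
pose G : set (topdual X * R) :=
  [set z : topdual X * R |
    exists n, forall k, (n <= k)%N -> z.1 (x_ k) <= z.2].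
have Gnorm f : G (f, C * `|f|).
  exists 0%N => k _; apply: le_trans (topdual_le_opnorm _ _) _.
  by rewrite /= mulrC; apply: ler_wpM2r; [exact: (normr_ge0 f)|].
have coneG : dominating_cone G.
  split.
  - move=> f g c d [n fn] [m gm]; exists (maxn n m) => k /=.
    by rewrite geq_max => /andP[nk mk]; apply: lerD; [exact: fn|exact: gm].
  - move=> t f c t0 [n fn]; exists n => k nk /=.
    by apply: ler_wpM2l => //; exact: fn.
  - by move=> f; exists (C * `|f|).
  - by move=> c [n /(_ n (leqnn n))].
have [F FG] := topdual_dominated coneG Gnorm.
have [x Fx] := reflX F; exists x => f n c fc.
by rewrite -Fx; apply: FG; exists n.
Qed.

(** If [f x] exceeded a bound [c] valid on a tail, the weakly open half-space [c < f] would be a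
    neighbourhood of the topological cluster point [x] missing that tail. *)
Lemma weakly_relatively_compact_weak_cluster (A : set X) (x_ : nat -> X) :
    weakly_relatively_compact A -> (forall n, A (x_ n)) ->
  exists x, weak_cluster_point x_ x.
Proof.
rewrite /weakly_relatively_compact precompactE => cA Ax.
pose F := fmap (x_ : nat -> weak X) \oo.
have [|x [_ xcl]] := cA F (fmap_proper_filter _ eventually_filter).
  by exists 0%N => // n _; apply: subset_closure; exact: Ax.
exists x => f n c fc; rewrite leNgt; apply/negP => cx.
have fcont : continuous (f : weak X -> R^o).
  move=> y B fyB; have /cvg_sup/(_ f) : nbhs (y : weak X) --> (y : weak X).
    exact: cvg_id.
  by apply; exact: (@initial_continuous X R^o f y B fyB).
have fx : nbhs (x : weak X) (f @^-1` [set y : R^o | c < y]).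
  by apply: fcont; exact: (@lt_nbhsr R).
have Ftail : F (x_ @` [set k | (n <= k)%N]).
  by exists n => // k nk; exists k.
by have [_ [[k nk <-] /=]] := xcl _ _ Ftail fx; rewrite ltNge fc.
Qed.

(** A point at distance at least [r > 0] from [S n] is separated from it by some [f] with gap [r];
    the bound [f x - r] then holds on a tail of the sequence, hence at [x], which is absurd. *)
Lemma Mazur (S : nat -> set X) (x_ : nat -> X) (x : X) :
    (forall n y z t, S n y -> S n z -> 0 <= t <= 1 ->
      S n (t *: y + (1 - t) *: z)) ->
    (forall n k, (n <= k)%N -> S n (x_ k)) -> weak_cluster_point x_ x ->
  forall n, closure (S n) x.
Proof.
move=> convS Sx xx n; apply: contrapT => nx.
have [r r0 rS] : exists2 r, 0 < r & forall y, S n y -> r <= `|x - y|.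
  apply: contrapT => Nr; apply: nx => B /nbhs_ballP[r /= r0 rB].
  apply: contrapT => SB; apply: Nr; exists r => // y Sy.
  rewrite leNgt; apply/negP => xy; apply: SB; exists y; split=> //.
  by apply: rB; rewrite -ball_normE.
have [|f fS] := separate_point_convex _ (convS n) rS.
  by exists (x_ n); exact: Sx.
have := xx f n (f x - r); rewrite lerBrDr gerDl leNgt r0 => fx.
suff : false by [].
by apply: fx => k nk; rewrite lerBrDr; apply: fS; exact: Sx.
Qed.
End WeakClusterPoints.

(** * Projections onto finite-dimensional spaces modulo the range of another projection *)

Section FiniteDimensional.
Context {R : realType} {X : normedModType R}.

Definition span n (e : 'I_n -> X) : set X :=
  range (fun c : 'I_n -> R => \sum_(i < n) c i *: e i).

(* [T] projects onto [V] along [range Q], up to an error in [range Q]. *)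
Definition projects_modulo (Q T : {linear X -> X}) (V : set X) : Prop :=
  [/\ continuous T, forall x, V (T x), forall x, T (Q x) = 0 &
      forall x, V x -> Q (x - T x) = x - T x].

(** The map [u], which is [(id - Q) (id - T)], kills [V] and [range Q]. If it also kills [a], then
    [T] still works. Otherwise a functional [f] that factors through [u] with [f a = 1] gives the
    correction [f x *: (a - T a)] to [T x]. *)
Lemma projects_modulo_adjoin (Q T : {linear X -> X}) (V : set X) (a : X) :
    continuous Q -> idempotent_fun Q ->
    (forall t x y, V x -> V y -> V (x + t *: y)) -> projects_modulo Q T V ->
  exists T',
    projects_modulo Q T' [set x | exists2 v, V v & exists t, x = v + t *: a].
Proof.
move=> cQ QQ linV [cT VT TQ QT].
pose u : {linear X -> X} := idfun \- (T \+ (Q \o (idfun \- T))).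
have uV v : V v -> u v = 0.
  by move=> Vv; rewrite /u /= QT// (addrC (T v)) subrK subrr.
have uQ x : u (Q x) = 0 by rewrite /u /= TQ add0r subr0 [Q (Q x)]QQ subrr.
have cu : continuous u.
  move=> x; apply: cvgB; first exact: cvg_id.
  apply: cvgD; first exact: cT.
  apply: (@continuous_comp _ _ _ (fun y => y - T y) Q); last exact: cQ.
  by apply: cvgB; [exact: cvg_id|exact: cT].
have [a0|a0] := eqVneq (u a) 0.
  exists T; split=> // [x|x [v Vv [t ->]]].
    by exists (T x) => //; exists 0; rewrite scale0r addr0.
  have Qa : Q (a - T a) = a - T a.
    apply/esym/eqP; rewrite subr_eq [X in _ == X]addrC; apply/eqP.
    exact: subr0_eq a0.
  have -> : v + t *: a - T (v + t *: a) = (v - T v) + t *: (a - T a).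
    by rewrite linearD linearZ /= opprD addrACA -scalerBr.
  by rewrite linearD linearZ /= QT// Qa.
have [g ga] := topdual_neq0 a0.
pose f : {linear X -> R^o} := (g (u a))^-1 \*: (g \o u).
have fE x : f x = (g (u a))^-1 * g (u x) by [].
have fV v : V v -> f v = 0 by move=> Vv; rewrite fE (uV v)// linear0 mulr0.
have fQ x : f (Q x) = 0 by rewrite fE uQ linear0 mulr0.
have fa : f a = 1 by exact: mulVf.
pose h x := T x + f x *: (a - T a).
have h_lin : linear h.
  move=> t x y; rewrite /h; move: (a - T a) => b.
  rewrite (linearP T) (linearP f) scalerDl [in RHS]scalerDr addrACA.
  by congr (_ + _ + _); exact/esym/scalerA.
pose T' :=
  HB.pack_for {linear X -> X} h (GRing.isLinear.Build R X X _ _ h_lin).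
have T'E x : T' x = T x + f x *: (a - T a) by [].
exists T'; split=> [x|x|x|_ [v Vv [t ->]]].
- apply: cvgD; first exact: cT.
  apply: cvgZr_tmp; apply: cvgZl_tmp.
  by apply: (@continuous_comp _ _ _ u g); [exact: cu|exact: topdual_continuous].
- exists (T x + - f x *: T a); first exact: linV.
  by exists (f x); rewrite T'E scalerBr scaleNr addrAC addrA.
- by rewrite T'E TQ fQ scale0r addr0.
- have Tvta : T (v + t *: a) = T v + t *: T a by rewrite linearD linearZ.
  have fvta : f (v + t *: a) = t.
    by rewrite linearD linearZ fV// fa add0r [LHS]mulr1.
  suff -> : v + t *: a - T' (v + t *: a) = v - T v by exact: QT.
  rewrite T'E fvta Tvta scalerBr [t *: a - _]addrC addrA addrK.
  by rewrite opprD addrACA subrr addr0.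
Qed.

Lemma span_addZ n (e : 'I_n -> X) t x y :
  span e x -> span e y -> span e (x + t *: y).
Proof.
move=> [c _ <-] [d _ <-]; exists (fun i => c i + t * d i) => //.
rewrite scaler_sumr -big_split; apply: eq_bigr => i _ /=.
by rewrite scalerDl scalerA.
Qed.

(** Induction on [n], adjoining the last vector [e ord_max] to the span of the others. *)
Lemma projects_modulo_span (Q : {linear X -> X}) n (e : 'I_n -> X) :
    continuous Q -> idempotent_fun Q ->
  exists T, projects_modulo Q T (span e).
Proof.
move=> cQ QQ; elim: n e => [|n IHn] e.
  exists (\0 : X -> X); split=> [x|x|x|_ [c _ <-]] /=.
  - exact: cvg_cst.
  - by exists (fun=> 0) => //; rewrite big_ord0.
  - by [].
  - by rewrite big_ord0 subr0 linear0.
have [T QT] := IHn (e \o widen_ord (leqnSn n)).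
have [T' QT'] := projects_modulo_adjoin (e ord_max) cQ QQ (@span_addZ _ _) QT.
exists T'; rewrite (_ : span e = [set x |
  exists2 v, span (e \o widen_ord (leqnSn n)) v &
  exists t, x = v + t *: e ord_max])//.
apply/seteqP; split=> [_ [c _ <-]|_ [_ [c _ <-] [t ->]]].
  exists (\sum_(i < n) c (widen_ord (leqnSn n) i) *:
                       e (widen_ord (leqnSn n) i)).
    by exists (c \o widen_ord (leqnSn n)).
  by exists (c ord_max); rewrite big_ord_recr.
exists (fun i => if unlift ord_max i is Some j then c j else t) => //.
rewrite big_ord_recr /= unlift_none; congr (_ + _); apply: eq_bigr => i _.
rewrite (_ : widen_ord _ i = lift ord_max i) ?liftK//.
by apply/val_inj; rewrite /= /bump leqNgt ltn_ord.
Qed.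
End FiniteDimensional.

(** * Elementary properties of semi-norms and of lower limits *)

Section Seminorm.
Context {R : realType} {X : normedModType R}.
Implicit Types (Phi : X -> \bar R).
Local Open Scope ereal_scope.

Lemma seminormN Phi u : lsc_seminorm Phi -> Phi (- u)%R = Phi u.
Proof. by move=> sPhi; rewrite -scaleN1r seminormZ// normrN1 mul1e. Qed.

Lemma seminormD_ker Phi u z :
  lsc_seminorm Phi -> Phi z = 0 -> Phi (u + z)%R = Phi u.
Proof.
move=> sPhi z0; apply/eqP; rewrite eq_le; apply/andP; split.
  by rewrite -[leRHS]adde0 -z0 seminormD.
rewrite -[X in Phi X](addrK z) -[leRHS]adde0 -z0 -(seminormN z sPhi).
exact: seminormD.
Qed.

Lemma seminorm_convex Phi (t : R) u v (a b : R) : lsc_seminorm Phi ->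
    (0 <= t <= 1)%R -> Phi u <= a%:E -> Phi v <= b%:E ->
  Phi (t *: u + (1 - t) *: v)%R <= (t * a + (1 - t) * b)%:E.
Proof.
move=> sPhi /andP[t0 t1] ua vb; apply: le_trans (seminormD sPhi _ _) _.
rewrite !seminormZ// !ger0_norm ?subr_ge0// [leRHS]EFinD !EFinM.
by apply: leeD; apply: lee_wpmul2l; rewrite ?lee_fin ?subr_ge0.
Qed.

Lemma range_idempotent (P : {linear X -> X}) x :
  idempotent_fun P -> range P x -> P x = x.
Proof. by move=> PP [y _ <-]; exact: PP. Qed.

Lemma ge0_sum_le_fin (x y : \bar R) (c : R) : 0 <= x -> 0 <= y ->
  x + y <= c%:E -> exists a b : R,
  [/\ x = a%:E, y = b%:E, (0 <= a)%R, (0 <= b)%R & (a + b <= c)%R].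
Proof.
move: x y => [a| |] [b| |] //=; rewrite ?lee_fin => a0 b0 ab.
by exists a, b.
Qed.

(** The inequality holds between the infima of the tails and [c n], and passes to the limit;
    nonnegativity makes the sum of the two lower limits well defined. *)
Lemma limn_einfD_le (a b c : nat -> \bar R) (l : \bar R) :
    (forall n, 0 <= a n) -> (forall n, 0 <= b n) ->
    (forall n, a n + b n <= c n) -> c @ \oo --> l ->
  limn_einf a + limn_einf b <= l.
Proof.
move=> a0 b0 abc cl.
have einfs_ge0 (x : nat -> \bar R) :
    (forall n, 0 <= x n) -> forall n, 0 <= einfs x n.
  by move=> x0 n; apply: le_ereal_inf_tmp => _ [k _ <-].
have liminf_ge0 (x : nat -> \bar R) :
    (forall n, 0 <= x n) -> 0 <= limn_einf x.
  move=> x0; rewrite limn_einf_lim; apply: lime_ge; first exact: is_cvg_einfs.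
  by apply: nearW; exact: einfs_ge0.
have cvg_liminf (x : nat -> \bar R) : einfs x @ \oo --> limn_einf x.
  by rewrite limn_einf_lim; exact: is_cvg_einfs.
have cvgab :
    (einfs a n + einfs b n) @[n --> \oo] --> limn_einf a + limn_einf b.
  by apply: cvgeD => //; apply: ge0_adde_def; rewrite inE liminf_ge0.
rewrite -(cvg_lim _ cvgab)// -(cvg_lim _ cl)//.
apply: lee_lim;
  [by apply/cvg_ex; eexists; exact: cvgab|by apply/cvg_ex; exists l|].
apply: nearW => n; apply: le_trans (abc n).
by apply: leeD; apply: ereal_inf_lbound; exists n => //=.
Qed.

End Seminorm.

(** * Projection onto the sum of the kernels, and bounds modulo their intersection *)

Section Infconv.
Context {R : realType} {X : normedModType R}.
Implicit Types (Phi : X -> \bar R).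

(** The map [T + Q (id - T)] takes its values in [V + range Q] and fixes every point of it. *)
Lemma projects_modulo_projection (Q T : {linear X -> X}) (V : set X) :
    continuous Q -> idempotent_fun Q -> projects_modulo Q T V ->
  exists P : {linear X -> X}, [/\ continuous P, idempotent_fun P &
    range P = [set x + y | x in V & y in range Q]].
Proof.
move=> cQ QQ [cT VT TQ QT].
pose P : {linear X -> X} := T \+ (Q \o (idfun \- T)).
have PE x : P x = T x + Q (x - T x) by [].
have PVQ x y : V x -> range Q y -> P (x + y) = x + y.
  move=> Vx Qy; have Qy' := range_idempotent QQ Qy.
  rewrite linearD !PE QT// -Qy' TQ add0r subr0 [Q (Q y)]QQ.
  by rewrite [T x + _]addrC subrK.
have PM x : V (T x) /\ range Q (Q (x - T x)) by split=> //; exists (x - T x).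
exists P; split=> [x|x|].
- apply: cvgD; first exact: cT.
  apply: (@continuous_comp _ _ _ (fun y => y - T y) Q); last exact: cQ.
  by apply: cvgB; [exact: cvg_id|exact: cT].
- by have [VTx QTx] := PM x; rewrite -[LHS]/(P (P x)) [X in P X]PE PVQ.
- apply/seteqP; split=> [_ [x _ <-]|_ [x Vx [y Qy <-]]].
    by have [VTx QTx] := PM x; exists (T x) => //; exists (Q (x - T x)).
  by exists (x + y) => //; exact: PVQ.
Qed.

Lemma linear_continuous_bound (T : {linear X -> X}) : continuous T ->
  exists2 M, 0 < M & forall x, `|T x| <= M * `|x|.
Proof.
by move=> /linear_bounded_continuous/linear_boundedP/pinfty_ex_gt0.
Qed.

Lemma coercive_bound Phi1 Phi2 (L : R) :
    lsc_seminorm Phi1 -> lsc_seminorm Phi2 -> coercive Phi1 -> coercive Phi2 ->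
    finite_dimensional (seminorm_ker Phi1) ->
  exists C, forall w v : X, `|w| <= L -> (Phi1 (w - v)%R <= L%:E)%E ->
    (Phi2 v <= L%:E)%E ->
  exists z, [/\ Phi1 z = 0%E, Phi2 z = 0%E & `|v - z| <= C].
Proof.
move=> sPhi1 sPhi2 [P1 [_ PP1 rP1] [C1 C1_gt0 cPhi1]].
move=> [P2 [cP2 PP2 rP2] [C2 C2_gt0 cPhi2]] [n [e ker1]].
have [T [cT VT TQ QT]] := projects_modulo_span e cP2 PP2.
have [M M_gt0 TM] := linear_continuous_bound cT.
(* The summands bound [v - w - a], [w] and [T (a - b)], where [a - b] is split as
   [(v - b) - (v - w - a) - w]. *)
exists (C1 * L + L + M * (C2 * L + C1 * L + L)) => w v wL Phi1L Phi2L.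
pose a := P1 (v - w); pose b := P2 v.
have va : `|v - w - a| <= C1 * L.
  rewrite -lee_fin; apply: le_trans (cPhi1 _) _; rewrite EFinM.
  apply: lee_wpmul2l; first by rewrite lee_fin ltW.
  by rewrite -(seminormN _ sPhi1) opprB.
have vb : `|v - b| <= C2 * L.
  rewrite -lee_fin; apply: le_trans (cPhi2 _) _; rewrite EFinM.
  by apply: lee_wpmul2l => //; rewrite lee_fin ltW.
have ab : `|a - b| <= C2 * L + C1 * L + L.
  have -> : a - b = (v - b) - (v - w - a) - w.
    rewrite (addrAC v (- w)) -[RHS]addrA -opprD subrK opprB [RHS]addrC.
    by rewrite addrA subrK.
  apply: le_trans (ler_normB _ _) _; apply: lerD => //.
  by apply: le_trans (ler_normB _ _) _; apply: lerD.
have Tb : T b = 0 by rewrite /b TQ.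
have Va : span e a by rewrite -[span e]ker1 -rP1; exists (v - w).
(* Both [a] and the values of [T] lie in [ker Phi1]. As [T b = 0], this point is also [a - T a],
   which [P2] fixes, so it lies in [ker Phi2]. *)
exists (a - T (a - b)); split.
- have : span e (a + -1 *: T (a - b)) by exact: span_addZ.
  by rewrite scaleN1r -[span e]ker1.
- suff : range P2 (a - T (a - b)) by rewrite rP2.
  by rewrite linearB Tb subr0 -(QT _ Va); exists (a - T a).
- rewrite opprB addrCA.
  have -> : T (a - b) + (v - a) = (v - w - a) + w + T (a - b).
    by rewrite addrC (addrAC v (- w)) subrK.
  apply: le_trans (ler_normD _ _) _; apply: lerD.
    by apply: le_trans (ler_normD _ _) _; apply: lerD.
  by apply: le_trans (TM _) _; rewrite ler_wpM2l// ltW.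
Qed.

End Infconv.

(** * Attainment of values approximated by the infimal convolution near a point *)

Section Main.
Context {R : realType} {X : normedModType R}.
Implicit Types (Phi : X -> \bar R).

(** The common consequence of reflexivity and of weakly relatively compact sublevels, and the only
    form in which compactness is used below. *)
Definition weak_cluster_sublevels Phi : Prop :=
  forall (C : R) (x_ : nat -> X),
    (forall n, (`|x_ n|%:E + Phi (x_ n) <= C%:E)%E) ->
    exists x, weak_cluster_point x_ x.

Lemma reflexive_weak_cluster_sublevels Phi :
  lsc_seminorm Phi -> reflexive_space X -> weak_cluster_sublevels Phi.
Proof.
move=> sPhi reflX C x_ xC; apply: (@reflexive_weak_cluster _ _ x_ C) => // n.
by rewrite -lee_fin (le_trans _ (xC n))// leeDl// seminorm_ge0.
Qed.

Lemma weakly_compact_weak_cluster_sublevels Phi :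
  weakly_compact_sublevels Phi -> weak_cluster_sublevels Phi.
Proof.
move=> cPhi C x_ xC.
(* Compactness is given for positive constants only, whereas [C] is arbitrary. *)
have C_gt0 : 0 < Num.max C 1 by rewrite lt_max ltr01 orbT.
apply: weakly_relatively_compact_weak_cluster (cPhi _ C_gt0) _ => n /=.
by apply: le_trans (xC n) _; rewrite lee_fin le_max lexx.
Qed.

Lemma infconv_closed_cluster_r Phi1 Phi2 (l : R) (u : X) :
    lsc_seminorm Phi1 -> lsc_seminorm Phi2 -> coercive Phi1 -> coercive Phi2 ->
    finite_dimensional (seminorm_ker Phi1) -> weak_cluster_sublevels Phi2 ->
    (forall e : R, 0 < e -> exists w v,
      `|u - w| <= e /\ (Phi1 (w - v)%R + Phi2 v <= (l + e)%:E)%E) ->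
  exists v, (Phi1 (u - v)%R + Phi2 v <= l%:E)%E.
Proof.
move=> sPhi1 sPhi2 coPhi1 coPhi2 fPhi1 wPhi2 appr.
(* One constant has to bound [|w| <= |u| + 1] and both semi-norm values, which are at most [l + 1];
   the absolute value keeps every summand nonnegative. *)
have [C CP] := @coercive_bound _ _ _ _ (`|u| + 1 + `|l + 1|)
  sPhi1 sPhi2 coPhi1 coPhi2 fPhi1.
pose d n : R := n.+1%:R^-1.
have d_gt0 n : 0 < d n by rewrite invr_gt0.
have d_le n k : (n <= k)%N -> d k <= d n.
  by move=> nk; rewrite lef_pV2 ?posrE// ler_nat.
have d_le1 n : d n <= 1.
  by rewrite -[leRHS]invr1 lef_pV2 ?posrE// ler1n.
pose S n : set X := [set v | `|v| <= C /\ exists w, `|u - w| <= d n /\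
  (Phi1 (w - v)%R + Phi2 v <= (l + d n)%:E)%E].
have S0 n : exists v, S n v.
  have [w [v [uw wv]]] := appr _ (d_gt0 n).
  have [a [b [ea eb a0 b0 ab]]] :=
    ge0_sum_le_fin (seminorm_ge0 sPhi1 _) (seminorm_ge0 sPhi2 _) wv.
  have ld : l + d n <= `|l + 1|.
    by apply: le_trans (ler_norm _); rewrite lerD2l.
  have [||//|z [z1 z2 vz]] := CP w v.
  - have := ler_normB u (u - w); rewrite subKr => uw'.
    by have := d_le1 n; have := normr_ge0 (l + 1); lra.
  - by rewrite ea lee_fin; have := normr_ge0 u; lra.
  - by rewrite eb lee_fin; have := normr_ge0 u; lra.
  exists (v - z); split=> //; exists w; split=> //.
  have -> : w - (v - z) = w - v + z by rewrite opprB addrCA addrC.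
  have z2' : Phi2 (- z) = 0%E by rewrite seminormN.
  by rewrite (seminormD_ker _ sPhi1 z1) (seminormD_ker _ sPhi2 z2').
have /choice[x_ Sx_] := S0.
have Smono n k : (n <= k)%N -> S k `<=` S n.
  move=> nk v [vC [w [uw wv]]]; split=> //; exists w; split.
    by apply: le_trans uw _; exact: d_le.
  by apply: le_trans wv _; rewrite lee_fin lerD2l d_le.
have Sconv n y z t :
    S n y -> S n z -> 0 <= t <= 1 -> S n (t *: y + (1 - t) *: z).
  move=> [yC [w1 [uw1 wv1]]] [zC [w2 [uw2 wv2]]] t01.
  have /andP[t0 t1] := t01.
  have conv_norm (p q : X) e :
      `|p| <= e -> `|q| <= e -> `|t *: p + (1 - t) *: q| <= e.
    move=> pe qe; apply: le_trans (ler_normD _ _) _.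
    rewrite !normrZ !ger0_norm ?subr_ge0//.
    have -> : e = t * e + (1 - t) * e by rewrite mulrBl mul1r addrC subrK.
    by apply: lerD; rewrite ler_wpM2l ?subr_ge0.
  split; first exact: conv_norm.
  exists (t *: w1 + (1 - t) *: w2).
  have conv_sub (p q p' q' : X) :
      t *: p + (1 - t) *: q - (t *: p' + (1 - t) *: q') =
      t *: (p - p') + (1 - t) *: (q - q').
    by rewrite !scalerBr opprD addrACA.
  split.
    rewrite (_ : u - _ = t *: (u - w1) + (1 - t) *: (u - w2)).
      exact: conv_norm.
    by rewrite -conv_sub -[t *: u + _]scalerDl [t + _]addrC subrK scale1r.
  have [a [b [ea eb a0 b0 ab]]] :=
    ge0_sum_le_fin (seminorm_ge0 sPhi1 _) (seminorm_ge0 sPhi2 _) wv1.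
  have [a' [b' [ea' eb' a0' b0' ab']]] :=
    ge0_sum_le_fin (seminorm_ge0 sPhi1 _) (seminorm_ge0 sPhi2 _) wv2.
  rewrite conv_sub.
  apply: le_trans (leeD (seminorm_convex (a := a) (b := a') sPhi1 t01 _ _)
    (seminorm_convex (a := b) (b := b') sPhi2 t01 _ _)) _;
    rewrite ?ea ?ea' ?eb ?eb'//.
  rewrite lee_fin.
  have -> : l + d n = t * (l + d n) + (1 - t) * (l + d n) by ring.
  rewrite addrACA -!mulrDr; apply: lerD; rewrite ler_wpM2l ?subr_ge0//.
(* On each [S n] one has [|v| <= C] and [Phi2 v <= l + d n <= l + 1], so the whole sequence lies in
   one sublevel. *)
have [n|x xx] := wPhi2 (C + (l + 1)) x_.
  have [xC [w [_ wv]]] := Sx_ n; rewrite EFinD; apply: leeD; first by rewrite lee_fin.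
  apply: le_trans (_ : _ <= (l + d n)%:E)%E _; last by rewrite lee_fin lerD2l.
  by apply: le_trans wv; rewrite leeDr// seminorm_ge0.
have Sx n : closure (S n) x.
  by apply: Mazur xx n => // n k nk; apply: Smono nk _ _; exact: Sx_.
(* Pairs of a point of [S n] close to [x] and its witness [w]: both components converge in norm, as
   lower semi-continuity requires. *)
have /choice[y yP] n : exists p : X * X,
    [/\ `|x - p.1| < d n, `|u - p.2| <= d n &
      (Phi1 (p.2 - p.1)%R + Phi2 p.1 <= (l + d n)%:E)%E].
  have [v [[_ [w [uw wv]]] vx]] := Sx n _ (nbhsx_ballx x _ (d_gt0 n)).
  by exists (v, w); split=> //; move: vx; rewrite -ball_normE.
have cvg_d (z_ : nat -> X) z : (forall n, `|z - z_ n| <= d n) -> z_ @ \oo --> z.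
  move=> zd; apply/cvgrPdist_le => e e0.
  have : \forall n \near \oo, d n < (PosNum e0)%:num by exact: near_infty_natSinv_lt.
  by apply: filterS => n de; apply: le_trans (zd n) (ltW de).
have cy : (fun n => (y n).1) @ \oo --> x.
  by apply: cvg_d => n; have [/ltW] := yP n.
have cw : (fun n => (y n).2) @ \oo --> u.
  by apply: cvg_d => n; have [] := yP n.
have cwy : (fun n => (y n).2 - (y n).1) @ \oo --> u - x by exact: cvgB.
exists x.
apply: le_trans (leeD (seminorm_lsc sPhi1 cwy) (seminorm_lsc sPhi2 cy)) _.
apply: (@limn_einfD_le _ _ _ (fun n => (l + d n)%:E)).
- by move=> n; exact: seminorm_ge0.
- by move=> n; exact: seminorm_ge0.
- by move=> n; have [] := yP n.
- apply: cvg_EFin; first exact: nearW.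
  rewrite -[X in _ --> X]addr0; apply: cvgD; first exact: cvg_cst.
  exact: cvg_harmonic.
Qed.

(** The substitution of [w - v] for [v] exchanges [Phi1] and [Phi2], so compactness on either side
    suffices. *)
Lemma infconv_closed Phi1 Phi2 (l : R) (u : X) :
    lsc_seminorm Phi1 -> lsc_seminorm Phi2 -> coercive Phi1 -> coercive Phi2 ->
    finite_dimensional (seminorm_ker Phi1) ->
    finite_dimensional (seminorm_ker Phi2) ->
    weak_cluster_sublevels Phi1 \/ weak_cluster_sublevels Phi2 ->
    (forall e : R, 0 < e -> exists w v,
      `|u - w| <= e /\ (Phi1 (w - v)%R + Phi2 v <= (l + e)%:E)%E) ->
  exists v, (Phi1 (u - v)%R + Phi2 v <= l%:E)%E.
Proof.
move=> sPhi1 sPhi2 coPhi1 coPhi2 fPhi1 fPhi2 [wPhi1|wPhi2] appr; last first.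
  exact: infconv_closed_cluster_r appr.
have [|v vl] := @infconv_closed_cluster_r _ _ l u
  sPhi2 sPhi1 coPhi2 coPhi1 fPhi2 wPhi1.
  move=> e /appr[w [v [uw wv]]]; exists w, (w - v); split=> //.
  by rewrite subKr addeC.
by exists (u - v); rewrite subKr addeC.
Qed.

Lemma finite_dimensionalD (A B : set X) :
    finite_dimensional A -> finite_dimensional B ->
  finite_dimensional [set x + y | x in A & y in B].
Proof.
move=> [n [e ->]] [m [f ->]].
exists (n + m)%N, (fun i : 'I_(n + m) =>
  match fintype.split i with inl j => e j | inr j => f j end).
apply/seteqP; split=> [_ [_ [c _ <-] [_ [d _ <-] <-]]|_ [c _ <-]].
  exists (fun i => match fintype.split i with inl j => c j | inr j => d j end).
    by [].
  rewrite big_split_ord /=; congr (_ + _); apply: eq_bigr => i _.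
    by rewrite (unsplitK (inl i : 'I_n + 'I_m)).
  by rewrite (unsplitK (inr i : 'I_n + 'I_m)).
exists (\sum_(i < n) c (lshift m i) *: e i); first by exists (c \o lshift m).
exists (\sum_(i < m) c (rshift n i) *: f i); first by exists (c \o @rshift n m).
rewrite big_split_ord /=; congr (_ + _); apply: eq_bigr => i _.
  by rewrite (unsplitK (inl i : 'I_n + 'I_m)).
by rewrite (unsplitK (inr i : 'I_n + 'I_m)).
Qed.

End Main.

(** * Exactness and the semi-norm axioms for the infimal convolution *)

Section Exactness.
Context {R : realType} {X : normedModType R}.
Context (Phi1 Phi2 : X -> \bar R).
Context (sPhi1 : lsc_seminorm Phi1) (sPhi2 : lsc_seminorm Phi2).

Lemma infconv_le u v : (infconv Phi1 Phi2 u <= Phi1 (u - v)%R + Phi2 v)%E.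
Proof. by apply: ereal_inf_lbound; exists v. Qed.

Lemma infconv_ge0 u : (0 <= infconv Phi1 Phi2 u)%E.
Proof.
apply: le_ereal_inf_tmp => _ [v _ <-].
by rewrite adde_ge0 ?seminorm_ge0.
Qed.

Lemma infconvZ_le (a : R) u :
    (exists v, Phi1 (u - v)%R + Phi2 v = infconv Phi1 Phi2 u)%E ->
  (infconv Phi1 Phi2 (a *: u) <= `|a|%:E * infconv Phi1 Phi2 u)%E.
Proof.
move=> [v <-]; apply: le_trans (infconv_le _ (a *: v)) _.
by rewrite -scalerBr !seminormZ// ge0_muleDr ?seminorm_ge0.
Qed.

Context (cPhi1 : coercive Phi1) (cPhi2 : coercive Phi2).
Context (fPhi1 : finite_dimensional (seminorm_ker Phi1))
  (fPhi2 : finite_dimensional (seminorm_ker Phi2)).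
Context (wPhi : weak_cluster_sublevels Phi1 \/ weak_cluster_sublevels Phi2).

Lemma infconv_exact u :
  exists v, (Phi1 (u - v)%R + Phi2 v = infconv Phi1 Phi2 u)%E.
Proof.
have := infconv_ge0 u; case infu : (infconv Phi1 Phi2 u) => [l| |]// _; last first.
  (* When the infimum is infinite, every point attains it. *)
  by exists 0; apply/eqP; rewrite -leye_eq -infu infconv_le.
have [e e_gt0|v vl] := @infconv_closed _ _ _ _ l u
  sPhi1 sPhi2 cPhi1 cPhi2 fPhi1 fPhi2 wPhi.
  have : (infconv Phi1 Phi2 u < (l + e)%:E)%E by rewrite infu lte_fin ltrDl.
  move=> /ereal_inf_lt[_ [v _ <-] /ltW vle].
  by exists u, v; rewrite subrr normr0 ltW.
by exists v; apply/eqP; rewrite eq_le vl/= -infu infconv_le.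
Qed.

Lemma infconvZ (a : R) u :
  (infconv Phi1 Phi2 (a *: u) = `|a|%:E * infconv Phi1 Phi2 u)%E.
Proof.
apply/eqP; rewrite eq_le infconvZ_le/=; last exact: infconv_exact.
have [->|a0] := eqVneq a 0; first by rewrite normr0 mul0e infconv_ge0.
(* The converse inequality is the same one for the factor [a^-1] at the point [a *: u]. *)
have := infconvZ_le a^-1 (infconv_exact (a *: u)).
rewrite scalerA mulVf// scale1r => /(lee_wpmul2l _).
move=> /(_ `|a|%:E); rewrite lee_fin normr_ge0 => /(_ isT).
by rewrite muleA -EFinM -normrM divff// normr1 mul1e.
Qed.

Lemma infconvD u v : (infconv Phi1 Phi2 (u + v)%R <=
  infconv Phi1 Phi2 u + infconv Phi1 Phi2 v)%E.
Proof.
have [[u' <-] [v' <-]] := (infconv_exact u, infconv_exact v).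
apply: le_trans (infconv_le _ (u' + v')) _.
rewrite opprD addrACA addeACA.
by apply: leeD; apply: seminormD.
Qed.

Lemma infconv_lsc (u_ : nat -> X) u : u_ @ \oo --> u ->
  (infconv Phi1 Phi2 u <= limn_einf (infconv Phi1 Phi2 \o u_))%E.
Proof.
move=> cu; rewrite limn_einf_lim.
set x := infconv Phi1 Phi2 \o u_.
have x_le n : (einfs x n <= limn (einfs x))%E.
  rewrite (cvg_lim _ (@cvg_einfs_sup _ x))//.
  by apply: ereal_sup_ubound; exists n.
have : (0 <= limn (einfs x))%E.
  apply: le_trans (x_le 0%N).
  by apply: le_ereal_inf_tmp => _ [k _ <-]; exact: infconv_ge0.
case liml : (limn (einfs x)) => [l| |]// _; last exact: leey.
have [e e_gt0|v vl] := @infconv_closed _ _ _ _ l u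
  sPhi1 sPhi2 cPhi1 cPhi2 fPhi1 fPhi2 wPhi.
  (* Past [N] the sequence is within [e] of [u], and the infimum of that tail is below [l + e], so
     some [k >= N] meets both requirements. *)
  have [N _ uN] := (cvgrPdist_le _ _).1 cu e e_gt0.
  have : (einfs x N < (l + e)%:E)%E.
    by apply: le_lt_trans (x_le N) _; rewrite liml lte_fin ltrDl.
  move=> /ereal_inf_lt[_ [k /= Nk <-] /ltW xk].
  have [v vE] := infconv_exact (u_ k).
  by exists (u_ k), v; split; [exact: uN|rewrite vE].
exact: le_trans (infconv_le u v) vl.
Qed.

(** Where the value is [0], exactness gives [v] with both terms [0], and [u = (u - v) + v] is the
    decomposition. *)
Lemma infconv_ker : seminorm_ker (infconv Phi1 Phi2) =
  [set x + y | x in seminorm_ker Phi1 & y in seminorm_ker Phi2].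
Proof.
apply/seteqP; split=> [u /= u0|_ [x x0 [y y0 <-]]].
  have [v] := infconv_exact u; rewrite u0 => /eqP.
  rewrite padde_eq0 ?seminorm_ge0// => /andP[/eqP uv0 /eqP v0].
  by exists (u - v) => //; exists v => //; rewrite subrK.
apply/eqP; rewrite eq_le infconv_ge0 andbT.
by rewrite (le_trans (infconv_le _ y))// addrK x0 y0 adde0.
Qed.

Lemma infconv_kernel_projection :
  exists P, kernel_projection (infconv Phi1 Phi2) P.
Proof.
have [P2 [cP2 PP2 rP2] _] := cPhi2.
have [n [e ker1]] := fPhi1.
have [T QT] := projects_modulo_span e cP2 PP2.
have [P [cP PP rP]] := projects_modulo_projection cP2 PP2 QT.
by exists P; split=> //; rewrite rP infconv_ker ker1 rP2.
Qed.

Lemma infconv_lsc_seminorm : lsc_seminorm (infconv Phi1 Phi2).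
Proof.
split; [exact: infconv_ge0| |exact: infconvZ|exact: infconvD|
  exact: infconv_lsc|exact: infconv_kernel_projection].
(* Properness: homogeneity with factor [0] gives the value [0] at the origin. *)
by exists 0; rewrite -(scale0r 0) infconvZ normr0 mul0e.
Qed.

End Exactness.

Theorem lemma4 (R : realType) (X : completeNormedModType R)
    (Phi1 Phi2 : X -> \bar R)
    (hPhi1 : lsc_seminorm Phi1) (hPhi2 : lsc_seminorm Phi2)
    (cPhi1 : coercive Phi1) (cPhi2 : coercive Phi2)
    (kPhi1 : finite_dimensional (seminorm_ker Phi1))
    (kPhi2 : finite_dimensional (seminorm_ker Phi2))
    (hab : reflexive_space X \/
      (weakly_compact_sublevels Phi1 \/ weakly_compact_sublevels Phi2)) :
  [/\ forall u : X, exists v : X,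
        argmin (fun w : X => (Phi1 (u - w)%R + Phi2 w)%E) v,
      lsc_seminorm (infconv Phi1 Phi2) &
      finite_dimensional (seminorm_ker (infconv Phi1 Phi2))].
Proof.
have wPhi : weak_cluster_sublevels Phi1 \/ weak_cluster_sublevels Phi2.
  have [reflX|[wPhi|wPhi]] := hab.
  - by left; exact: reflexive_weak_cluster_sublevels.
  - by left; exact: weakly_compact_weak_cluster_sublevels.
  - by right; exact: weakly_compact_weak_cluster_sublevels.
split.
- move=> u; have [v uv] := infconv_exact hPhi1 hPhi2 cPhi1 cPhi2 kPhi1 kPhi2 wPhi u.
  by exists v => w; rewrite /= uv; exact: infconv_le.
- exact: infconv_lsc_seminorm.
- rewrite infconv_ker//; exact: finite_dimensionalD.
Qed.
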